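(* Let $r\ge2$ and let $c_1,\ldots,c_{r-1},\Lambda_{2r-1}$ be independent variables. On the open set $c_{r-1}\ne0$, the variables $\Lambda_r,\ldots,\Lambda_{2r-1}$ form a rational coordinate system equivalent to $c_1,\ldots,c_{r-1},\Lambda_{2r-1}$, where $$\Lambda_m=-\sum_{a=1}^{r-1}c_ac_{m-a}\qquad(r\le m\le 2r-2)$$ (with $c_a=0$ for $a<1$ or $a>r-1$). In these coordinates, the vector fields $\mathcal V_0,\ldots,\mathcal V_{r-1}$ are given by $$\mathcal V_n=\sum_{\ell=r}^{2r-1-n}(\ell-n)\Lambda_{\ell+n}\frac{\partial}{\partial\Lambda_\ell},\qquad 0\le n\le r-1,$$ where $\Lambda_N=0$ for $N>2r-1$.
   Context: Definition of the vector fields. $\mathcal V_0=\sum_{k=1}^{r-1}kc_k\frac{\partial}{\partial c_k}+(2r-1)\Lambda_{2r-1}\frac{\partial}{\partial\Lambda_{2r-1}}$. For $1\le n\le r-1$, $\mathcal V_n$ is the unique rational vector field of the form $\sum_{k=1}^{r-n}h_{n,k}(c_1,\ldots,c_{r-1},\Lambda_{2r-1})\frac{\partial}{\partial c_k}$ such that $\mathcal V_n(\Lambda_m)=(m-n)\Lambda_{m+n}$ for $r\le m\le 2r-1$. ''Rational coordinate system'' here means that the Jacobian determinant of $(\Lambda_r,\ldots,\Lambda_{2r-1})$ with respect to $(c_1,\ldots,c_{r-1},\Lambda_{2r-1})$ is invertible after localizing at $c_{r-1}$, so that rational derivations are uniquely determined by their values on $\Lambda_r,\ldots,\Lambda_{2r-1}$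 and the derivations $\partial/\partial\Lambda_\ell$ are well defined. *)

(* Defs.v *)
From mathcomp Require Import all_boot all_order all_algebra ring.
From mathcomp Require Export mpoly.

Set Implicit Arguments.
Unset Strict Implicit.
Unset Printing Implicit Defensive.

Import GRing.Theory.
Local Open Scope ring_scope.
Local Open Scope quotient_scope.

Notation ratfun F r := {fraction {mpoly F[r]}}.

Fact quotient_rule_eq (A : comPzRingType) (a b p q a' b' p' q' : A) :
  a * q = p * b -> a' * q + a * q' = p' * b + p * b' ->
  (a' * b - a * b') * q ^+ 2 = (p' * q - p * q') * b ^+ 2.
Proof.
move=> ab dab; apply/eqP; rewrite -subr_eq0; apply/eqP.
transitivity (b * q * ((a' * q + a * q') - (p' * b + p * b'))
              - (b' * q + b * q') * (a * q - p * b)); first by ring.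
by rewrite dab ab !subrr !mulr0 subrr.
Qed.

Fact eq_div_sqr (L : fieldType) (x y u v : L) : u != 0 -> v != 0 ->
  x * v ^+ 2 = y * u ^+ 2 -> x / u ^+ 2 = y / v ^+ 2.
Proof. by move=> u0 v0 e; apply/eqP; rewrite eqr_div ?expf_neq0 //; apply/eqP. Qed.

Section RationalFunctions.
Variables (F : fieldType) (r : nat).
Local Notation P := {mpoly F[r]}.
Local Notation K := (ratfun F r).

(* Quotient rule on the representative fraction chosen by [repr];
   [fpartial_frac] below shows that any other representative gives the same
   value. *)
Definition fpartial (i : 'I_r) (f : K) : K :=
  let p : P := \n_(repr f) in
  let q : P := \d_(repr f) in
  tofrac (p^`M(i) * q - p * q^`M(i)) / tofrac q ^+ 2.

Lemma fpartial_frac (i : 'I_r) (p q : P) : q != 0 ->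
  fpartial i (tofrac p / tofrac q) =
  tofrac (p^`M(i) * q - p * q^`M(i)) / tofrac q ^+ 2.
Proof.
move=> q0; set f : K := tofrac p / tofrac q.
set a : P := \n_(repr f); set b : P := \d_(repr f).
have -> : fpartial i f =
    tofrac (a^`M(i) * b - a * b^`M(i)) / tofrac b ^+ 2 by [].
have b0 : b != 0 by exact: denom_ratioP.
have tb0 : tofrac b != 0 :> K by rewrite tofrac_eq0.
have tq0 : tofrac q != 0 :> K by rewrite tofrac_eq0.
have fE : f * tofrac b = tofrac a.
  rewrite -[f]reprK -[LHS]/(FracField.mul _ _); apply/eqP.
  rewrite !piE FracField.equivfE /FracField.mulf.
  by rewrite !numden_Ratio ?mulf_neq0 ?denom_ratioP ?oner_eq0 // !mulr1 mulrC.
have ab : a * q = p * b.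
  apply/eqP; rewrite -tofrac_eq !tofracM -fE /f.
  by rewrite mulrAC mulfVK.
have dab : a^`M(i) * q + a * q^`M(i) = p^`M(i) * b + p * b^`M(i).
  by rewrite -!mderivM ab.
clearbody a b; clear fE f.
apply: eq_div_sqr tb0 tq0 _.
rewrite -(tofracXn 2 q) -(tofracXn 2 b) -!tofracM.
by rewrite (quotient_rule_eq ab dab).
Qed.

Definition is_derivation (D : K -> K) : Prop :=
  [/\ forall f g, D (f + g) = D f + D g,
      forall f g, D (f * g) = D f * g + f * D g
    & forall a : F, D (tofrac a%:MP) = 0].

(* The subring F[x_0, ..., x_(r-1)][1/s] of F(x_0, ..., x_(r-1)). *)
Definition in_localization (s : P) (f : K) : Prop :=
  exists (p : P) (N : nat), f = tofrac p / tofrac s ^+ N.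

Definition unit_after_localization (s p : P) : Prop :=
  exists2 g : K, in_localization s g & tofrac p * g = 1.

Definition jacobian (y : 'I_r -> P) : P :=
  \det (\matrix_(i < r, j < r) (y i)^`M(j)).

(* The r independent variables c_1, ..., c_(r-1), Lambda_(2r-1) are, in this
   order, 'X_0, ..., 'X_(r-1). The next two definitions only allow to index
   them by a natural number; they take the value 0 out of range. *)
Definition coord (j : nat) : P :=
  if insub j is Some i then 'X_i else 0.

Definition dcoord (j : nat) (f : K) : K :=
  if insub j is Some i then fpartial i f else 0.

Definition cvar (a : nat) : P :=
  if (1 <= a <= r - 1)%N then coord (a - 1) else 0.

Definition dcvar (k : nat) (f : K) : K := dcoord (k - 1) f.

Definition Lambda_top : P := coord (r - 1).

Definition dLambda_top (f : K) : K := dcoord (r - 1) f.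

(* Only the values at m >= r are used. *)
Definition Lambda (m : nat) : P :=
  if (r <= m <= 2 * r - 2)%N then
    - \sum_(1 <= a < r) cvar a * cvar (m - a)
  else if m == (2 * r - 1)%N then Lambda_top
  else 0.

Definition calV0 (f : K) : K :=
  \sum_(1 <= k < r) k%:R * tofrac (cvar k) * dcvar k f
  + (2 * r - 1)%:R * tofrac Lambda_top * dLambda_top f.

(* [is_calV n V]: V is the vector field V_n, as an operator on rational
   functions. *)
Definition is_calV (n : nat) (V : K -> K) : Prop :=
  if n == 0%N then V =1 calV0
  else (exists h : nat -> K,
          forall f, V f = \sum_(1 <= k < (r - n).+1) h k * dcvar k f)
       /\ (forall m, (r <= m <= 2 * r - 1)%N ->
             V (tofrac (Lambda m)) = (m%:R - n%:R) * tofrac (Lambda (m + n))).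

(* [is_dLambda l D]: D is the derivation d/dLambda_l attached to the
   coordinates Lambda_r, ..., Lambda_(2r-1). *)
Definition is_dLambda (l : nat) (D : K -> K) : Prop :=
  is_derivation D
  /\ (forall m, (r <= m <= 2 * r - 1)%N ->
        D (tofrac (Lambda m)) = (m == l)%:R).

End RationalFunctions.

(* Main.v *)
(* The matrix of the partial derivatives of Lambda_r, ..., Lambda_(2r-1) with
   respect to c_1, ..., c_(r-1), Lambda_(2r-1) is upper triangular, with diagonal
   -2 c_(r-1), ..., -2 c_(r-1), 1; its determinant (-2 c_(r-1))^(r-1) is therefore
   invertible once c_(r-1) is.  A derivation of the rational function field that
   kills constants is a combination of the partial derivatives, so it is
   determined by its values on the Lambda_m, and these can be prescribed.
   For n >= 1, Lambda_(m+n) vanishes for the last n rows m, and back substitution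
   in the triangular system shows that V_n only involves
   d/dc_1, ..., d/dc_(r-n). *)
Require Import Defs.
From mathcomp Require Import all_boot all_order all_algebra ring zify.
Import GRing.Theory.
Set Implicit Arguments.
Unset Strict Implicit.
Unset Printing Implicit Defensive.
Local Open Scope ring_scope.
Local Open Scope quotient_scope.

(** * Algebraic identities for the quotient rule, and triangular systems *)

Lemma quotient_rule_add (L : fieldType) (p q p' q' dp dq dp' dq' : L) :
  q != 0 -> q' != 0 ->
  ((dp * q' + p * dq' + (dp' * q + p' * dq)) * (q * q')
     - (p * q' + p' * q) * (dq * q' + q * dq')) / (q * q') ^+ 2
  = (dp * q - p * dq) / q ^+ 2 + (dp' * q' - p' * dq') / q' ^+ 2.
Proof. by move=> q0 q'0; field; rewrite q0 q'0. Qed.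

Lemma quotient_rule_mul (L : fieldType) (p q p' q' dp dq dp' dq' : L) :
  q != 0 -> q' != 0 ->
  ((dp * p' + p * dp') * (q * q') - p * p' * (dq * q' + q * dq')) / (q * q') ^+ 2
  = (dp * q - p * dq) / q ^+ 2 * (p' / q')
    + p / q * ((dp' * q' - p' * dq') / q' ^+ 2).
Proof. by move=> q0 q'0; field; rewrite q0 q'0. Qed.

Lemma mderivXU (R : nzRingType) (r : nat) (i j : 'I_r) :
  'X_i^`M(j) = (i == j)%:R :> {mpoly R[r]}.
Proof.
rewrite mderivX mnm1E; case: eqP => [->|_]; last by rewrite scale0r.
rewrite scale1r; have -> : (U_(j) - U_(j) = 0 :> 'X_{1..r})%MM; last exact: mpolyX0.
by apply/mnmP => k; rewrite mnmBE mnm0E subnn.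
Qed.

Lemma sum_delta (A : pzSemiRingType) (b m n : nat) (f : nat -> A) :
  \sum_(m <= a < n) (a == b)%:R * f a = if (m <= b < n)%N then f b else 0.
Proof.
rewrite -(big_nat1_eq +%R) [RHS]big_mkcond; apply: eq_bigr => a _.
by case: eqP => _; rewrite ?mul1r ?mul0r.
Qed.

(** Back substitution: once the later entries at or beyond [k] vanish, row [i] reduces to
    [A i i * x i 0 = 0], with nonzero pivot. *)
Lemma upper_solve_support (L : fieldType) (r : nat) (A : 'M[L]_r) (b : 'cV[L]_r)
    (k : nat) :
  (forall i j : 'I_r, (j < i)%N -> A i j = 0) -> (forall i, A i i != 0) ->
  A \in unitmx -> (forall i : 'I_r, (k <= i)%N -> b i 0 = 0) ->
  forall i : 'I_r, (k <= i)%N -> (invmx A *m b) i 0 = 0.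
Proof.
move=> Alow Adiag Aunit b0; set x := _ *m b.
have Ax : A *m x = b by rewrite mulKVmx.
(* Induction on the number [n] of bottom rows already solved. *)
suff H n : forall i : 'I_r, (r - n <= i)%N -> (k <= i)%N -> x i 0 = 0.
  by move=> i; apply: (H r); rewrite subnn.
elim: n => [|n IH] i; first by have := ltn_ord i; lia.
move=> ni ki; have := b0 i ki; rewrite -Ax mxE (bigD1 i) //= big1 ?addr0.
  by move/eqP; rewrite mulf_eq0 (negPf (Adiag i)) => /eqP.
move=> j ji; have [lt|ge] := ltnP j i; first by rewrite Alow // mul0r.
have ij : (i < j)%N by rewrite ltn_neqAle ge eq_sym val_eqE ji.
by rewrite IH ?mulr0 //; lia.
Qed.

(** * Derivations of the rational function field *)

Section Derivations.
Variables (F : fieldType) (r : nat).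
Local Notation P := {mpoly F[r]}.
Local Notation K := (ratfun F r).
Local Notation tf := (@tofrac P).

Lemma ratfun_frac (f : K) : exists p q : P, q != 0 /\ f = tf p / tf q.
Proof.
exists (\n_(repr f)), (\d_(repr f)).
have q0 : \d_(repr f) != 0 := denom_ratioP _.
have tq0 : tf \d_(repr f) != 0 by rewrite tofrac_eq0.
split=> //; apply: (mulIf tq0); rewrite divfK //.
(* The product is computed on representatives, where equality of fractions is equality of cross
   products. *)
rewrite -[X in X * _]reprK -[LHS]/(FracField.mul _ _); apply/eqP.
rewrite !piE FracField.equivfE /FracField.mulf.
by rewrite !numden_Ratio ?mulf_neq0 ?oner_eq0 // !mulr1 mulrC.
Qed.

Lemma fpartial_tofrac (i : 'I_r) (p : P) : fpartial i (tf p) = tf p^`M(i).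
Proof.
have := fpartial_frac i p (oner_neq0 P); rewrite tofrac1 divr1 => ->.
have -> : (1 : P)^`M(i) = 0 by rewrite -mpolyC1 mderivC.
by rewrite mulr0 subr0 mulr1 expr1n divr1.
Qed.

Lemma fpartial_derivation (i : 'I_r) : is_derivation (@fpartial F r i).
Proof.
split=> [f g|f g|a]; last by rewrite fpartial_tofrac mderivC tofrac0.
all: have [p [q [q0 fE]]] := ratfun_frac f.
all: have [p' [q' [q'0 gE]]] := ratfun_frac g.
all: have tq0 : tf q != 0 by rewrite tofrac_eq0.
all: have tq'0 : tf q' != 0 by rewrite tofrac_eq0.
all: have df := fpartial_frac i p q0; rewrite -fE in df.
all: have dg := fpartial_frac i p' q'0; rewrite -gE in dg.
- have fgE : f + g = tf (p * q' + p' * q) / tf (q * q').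
    rewrite fE gE tofracD !tofracM.
    (* Without this generalization, unification unfolds [tofrac] and diverges. *)
    move: (tf p) (tf q) (tf p') (tf q') tq0 tq'0 => a b c d b0 d0.
    exact (addf_div a c b0 d0).
  have := fpartial_frac i (p * q' + p' * q) (mulf_neq0 q0 q'0).
  rewrite -fgE df dg mderivD !mderivM => ->.
  rewrite !(tofracB, tofracD, tofracM).
  move: (tf p) (tf q) (tf p') (tf q') tq0 tq'0 => a b c d b0 d0.
  move: (tf p^`M(i)) (tf q^`M(i)) (tf p'^`M(i)) (tf q'^`M(i)) => a' b' c' d'.
  exact (quotient_rule_add a c a' b' c' d' b0 d0).
- have fgE : f * g = tf (p * p') / tf (q * q').
    rewrite fE gE !tofracM.
    move: (tf p) (tf q) (tf p') (tf q') => a b c d.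
    exact (mulf_div a b c d).
  have := fpartial_frac i (p * p') (mulf_neq0 q0 q'0).
  rewrite -fgE df dg fE gE !mderivM => ->.
  rewrite !(tofracB, tofracD, tofracM).
  move: (tf p) (tf q) (tf p') (tf q') tq0 tq'0 => a b c d b0 d0.
  move: (tf p^`M(i)) (tf q^`M(i)) (tf p'^`M(i)) (tf q'^`M(i)) => a' b' c' d'.
  exact (quotient_rule_mul a c a' b' c' d' b0 d0).
Qed.

Lemma derivation_comb (I : Type) (s : seq I) (w : I -> K) (D : I -> K -> K) :
  (forall i, is_derivation (D i)) ->
  is_derivation (fun f => \sum_(i <- s) w i * D i f).
Proof.
move=> dD; split=> [f g|f g|a].
- by rewrite -big_split; apply: eq_bigr => i _; case: (dD i) => -> _ _; rewrite mulrDr.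
- rewrite mulr_suml mulr_sumr -big_split; apply: eq_bigr => i _ /=.
  by case: (dD i) => _ -> _; ring.
- by apply: big1 => i _; case: (dD i) => _ _ ->; rewrite mulr0.
Qed.

(** Additivity and the Leibniz rule carry agreement from the variables to monomials and polynomials;
    for f = p/q, the Leibniz rule on f q = p then forces the value at f. *)
Lemma derivation_ext (D1 D2 : K -> K) : is_derivation D1 -> is_derivation D2 ->
  (forall i, D1 (tf 'X_i) = D2 (tf 'X_i)) -> D1 =1 D2.
Proof.
move=> [A1 M1 C1] [A2 M2 C2] eqX.
have eqP p : D1 (tf p) = D2 (tf p).
  elim/mpolyind: p => [|c m p _ _ IH]; first by rewrite -mpolyC0 C1 C2.
  rewrite -mul_mpolyC tofracD A1 A2 IH tofracM M1 M2 C1 C2 !mul0r !add0r.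
  congr (_ * _ + _); rewrite mpolyXE_id.
  elim/big_ind: _ => [|p1 p2 e1 e2|i _]; first by rewrite -mpolyC1 C1 C2.
    by rewrite tofracM M1 M2 e1 e2.
  elim: (m i) => [|k IHk]; first by rewrite expr0 -mpolyC1 C1 C2.
  by rewrite exprS tofracM M1 M2 IHk eqX.
move=> f; have [p [q [q0 fE]]] := ratfun_frac f.
have tq0 : tf q != 0 by rewrite tofrac_eq0.
have fq : f * tf q = tf p by rewrite fE divfK.
have := eqP p; rewrite -fq M1 M2 eqP => /addIr; exact: mulIf.
Qed.

Lemma fpartialX (i j : 'I_r) : fpartial j (tf 'X_i) = (i == j)%:R.
Proof. by rewrite fpartial_tofrac mderivXU rmorph_nat. Qed.

Definition vfield (x : 'cV[K]_r) (f : K) : K := \sum_i x i 0 * fpartial i f.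

Lemma vfield_derivation (x : 'cV[K]_r) : is_derivation (vfield x).
Proof. by apply: derivation_comb => i; exact: fpartial_derivation. Qed.

Lemma vfieldX (x : 'cV[K]_r) (i : 'I_r) : vfield x (tf 'X_i) = x i 0.
Proof.
rewrite /vfield (bigD1 i) //= fpartialX eqxx mulr1 big1 ?addr0 // => j ji.
by rewrite fpartialX eq_sym (negPf ji) mulr0.
Qed.

(** Every derivation becomes a column of coefficients, so changing coordinates becomes linear
    algebra. *)
Lemma derivationE (D : K -> K) : is_derivation D ->
  D =1 vfield (\col_i D (tf 'X_i)).
Proof.
move=> dD; apply: (derivation_ext dD (vfield_derivation _)) => i.
by rewrite vfieldX mxE.
Qed.

Lemma derivation0 (D : K -> K) : is_derivation D -> D 0 = 0.
Proof. by case=> _ _ C; rewrite -[0](rmorph0 tf) -mpolyC0 C. Qed.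

Lemma derivationN (D : K -> K) : is_derivation D -> {morph D : f / - f}.
Proof.
move=> dD f; apply/eqP; rewrite -addr_eq0; apply/eqP; case: (dD) => A _ _.
by rewrite -A addNr derivation0.
Qed.

Lemma derivation_sum (D : K -> K) (I : Type) (s : seq I) (p : pred I) (f : I -> K) :
  is_derivation D -> D (\sum_(i <- s | p i) f i) = \sum_(i <- s | p i) D (f i).
Proof.
by move=> dD; case: (dD) => A _ _; apply: (big_morph D A); exact: derivation0.
Qed.

End Derivations.

(** * The variables c_a and the partial derivatives of the Lambda_m *)

Section Coordinates.
Variables (F : fieldType) (r : nat).
Local Notation P := {mpoly F[r]}.
Local Notation K := (ratfun F r).
Local Notation tf := (@tofrac P).

Lemma coordE (i : 'I_r) : Defs.coord F r i = 'X_i.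
Proof. by rewrite /Defs.coord valK. Qed.

Lemma dcoordE (i : 'I_r) (f : K) : dcoord i f = fpartial i f.
Proof. by rewrite /dcoord valK. Qed.

Lemma cvarE (i : 'I_r) : (i < r - 1)%N -> cvar F r i.+1 = 'X_i.
Proof. by move=> ir; rewrite /cvar ifT; [rewrite subn1 coordE | lia]. Qed.

Lemma cvar_out (a : nat) : (a == 0%N) || (r <= a)%N -> cvar F r a = 0.
Proof. by move=> ha; rewrite /cvar; case: ifP => //; lia. Qed.

Lemma cvar_neq0 : (2 <= r)%N -> cvar F r (r - 1) != 0.
Proof.
move=> r2; have lr : (r - 2 < r)%N by lia.
have -> : (r - 1 = (Ordinal lr).+1)%N by rewrite /=; lia.
rewrite cvarE /=; last by lia.
apply/negP => /eqP /(congr1 (fun p => p@_U_(Ordinal lr))).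
by rewrite mcoeffX eqxx mcoeff0 => /eqP; rewrite oner_eq0.
Qed.

Lemma cvar_mderiv (j : 'I_r) (a : nat) : (j < r - 1)%N ->
  (cvar F r a)^`M(j) = (a == j.+1)%:R.
Proof.
move=> jr; have [ha|ha] := boolP ((a == 0%N) || (r <= a)%N).
  by rewrite cvar_out // mderiv0; case: eqP => //; lia.
have lr : (a - 1 < r)%N by lia.
have -> : a = (Ordinal lr).+1 by rewrite /=; lia.
rewrite cvarE /=; last by lia.
by rewrite mderivXU eqSS -val_eqE.
Qed.

Lemma Lambda_lt (m : nat) : (r <= m < 2 * r - 1)%N ->
  Lambda F r m = - \sum_(1 <= a < r) cvar F r a * cvar F r (m - a).
Proof. by move=> hm; rewrite /Lambda; case: ifP => //; lia. Qed.

Lemma Lambda_last : Lambda F r (2 * r - 1) = Lambda_top F r.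
Proof.
rewrite /Lambda eqxx; case: ifP => // /andP[h1 h2].
(* With truncated subtraction, 2r-1 <= 2r-2 is possible only for r = 0, where both sides are 0. *)
have r0 : r = 0%N by lia.
by rewrite /Lambda_top /Defs.coord big_geq ?r0 ?oppr0 // insubF // r0.
Qed.

Lemma Lambda_gt (m : nat) : (0 < r)%N -> (2 * r <= m)%N -> Lambda F r m = 0.
Proof. by move=> r0 hm; rewrite /Lambda ifF ?ifF //; lia. Qed.

(** The variable c_(j+1) occurs once as left factor and once as right factor of the convolution;
    both occurrences contribute the same cofactor, whence the 2. *)
Lemma Lambda_mderiv (i j : 'I_r) : (i < r - 1)%N -> (j < r - 1)%N ->
  (Lambda F r (r + i))^`M(j) = - 2%:R * cvar F r (r + i - j.+1).
Proof.
move=> ir jr; rewrite Lambda_lt; last by lia.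
rewrite mderivN mulNr; congr (- _); rewrite raddf_sum.
transitivity (\sum_(1 <= a < r) ((a == j.+1)%:R * cvar F r (r + i - a)
    + (a == (r + i - j.+1)%N)%:R * cvar F r a)).
  apply: eq_big_nat => a ha /=; rewrite mderivM !cvar_mderiv //.
  by congr (_ + _); rewrite mulrC; congr (_%:R * _); lia.
rewrite big_split /= !sum_delta ifT; last by lia.
rewrite mulrDl mul1r; congr (_ + _); case: ifP => // h.
(* If the second index falls outside the summation range, its cofactor is itself 0. *)
by rewrite cvar_out //; lia.
Qed.

Lemma Lambda_last_mderiv (i j : 'I_r) : i = (r - 1)%N :> nat ->
  (Lambda F r (r + i))^`M(j) = (j == i)%:R.
Proof.
move=> ir; have -> : (r + i = 2 * r - 1)%N by lia.
by rewrite Lambda_last /Lambda_top -ir coordE mderivXU eq_sym.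
Qed.

(** * The Jacobian matrix and its determinant *)

Definition Lambda_jacobian_mx : 'M[P]_r :=
  \matrix_(i < r, j < r) (Lambda F r (r + i))^`M(j).

Local Notation J := Lambda_jacobian_mx.

(** Below the diagonal the index r+i-j-1 is at least r, so the c in that entry is 0; the last row
    differentiates the variable Lambda_(2r-1). *)
Lemma Lambda_jacobian_lower (i j : 'I_r) : (j < i)%N -> J i j = 0.
Proof.
move=> ji; rewrite mxE; have [ir|ir] := ltnP i (r - 1).
  by rewrite Lambda_mderiv ?cvar_out ?mulr0 //; lia.
rewrite Lambda_last_mderiv; last by have := ltn_ord i; lia.
by rewrite -val_eqE /= ltn_eqF.
Qed.

Lemma Lambda_jacobian_diag (i : 'I_r) :
  J i i = if (i < r - 1)%N then - 2%:R * cvar F r (r - 1) else 1.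
Proof.
rewrite mxE; case: ltnP => ir; last first.
  by rewrite Lambda_last_mderiv ?eqxx //; have := ltn_ord i; lia.
by rewrite Lambda_mderiv //; congr (_ * cvar _ _ _); lia.
Qed.

Lemma det_Lambda_jacobian : \det J = (- 2%:R * cvar F r (r - 1)) ^+ (r - 1).
Proof.
(* The transpose is lower triangular, the form [det_trig] expects. *)
rewrite -det_tr det_trig.
  under eq_bigr => i _ do rewrite mxE Lambda_jacobian_diag.
  rewrite -big_mkcond /= -(@big_ord_widen _ _ _ _ _ (fun=> _)) ?leq_subr //.
  by rewrite prodr_const card_ord.
by apply/is_trig_mxP => i j ij; rewrite mxE Lambda_jacobian_lower.
Qed.

Hypotheses (charF0 : [pchar F] =i pred0) (r_ge2 : (2 <= r)%N).

Lemma two_neq0 : 2%:R != 0 :> F.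
Proof. by have /pcharf0P -> := charF0. Qed.

Lemma two_cvar_neq0 : - 2%:R * cvar F r (r - 1) != 0.
Proof.
rewrite mulf_neq0 ?cvar_neq0 // oppr_eq0 -mpolyC_nat.
by rewrite mpolyC_eq0 two_neq0.
Qed.

Lemma Lambda_jacobian_unit : map_mx tf J \in unitmx.
Proof.
rewrite unitmxE det_map_mx det_Lambda_jacobian unitfE tofrac_eq0.
by rewrite expf_neq0 ?two_cvar_neq0.
Qed.

Lemma Lambda_jacobian_localization :
  unit_after_localization (cvar F r (r - 1))
    (jacobian (fun i : 'I_r => Lambda F r (r + i))).
Proof.
rewrite /jacobian -/J det_Lambda_jacobian.
(* Numerator of the inverse determinant; -2 is invertible in characteristic 0. *)
pose a : P := (- 2%:R)^-1%:MP ^+ (r - 1).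
exists (tf a / tf (cvar F r (r - 1)) ^+ (r - 1)); first by exists a, (r - 1)%N.
rewrite mulrA -tofracM exprMn /a mulrAC tofracM tofracXn mulfK; last first.
  by rewrite expf_neq0 // tofrac_eq0 cvar_neq0.
have -> : - 2%:R = (- 2%:R)%:MP :> P by rewrite mpolyCN mpolyC_nat.
rewrite -exprMn -mpolyCM mulfV ?oppr_eq0 ?two_neq0 //.
by rewrite mpolyC1 expr1n tofrac1.
Qed.

(** * Derivations with prescribed values on the Lambda_m *)

(** The chain rule in matrix form. *)
Lemma derivation_Lambda (D : K -> K) : is_derivation D ->
  \col_i D (tf (Lambda F r (r + i))) = map_mx tf J *m \col_i D (tf 'X_i).
Proof.
move=> dD; apply/colP => i; rewrite !mxE derivationE //.
by apply: eq_bigr => j _; rewrite !mxE fpartial_tofrac mulrC.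
Qed.

Lemma derivation_Lambda_ext (D1 D2 : K -> K) : is_derivation D1 -> is_derivation D2 ->
  (forall m, (r <= m <= 2 * r - 1)%N ->
     D1 (tf (Lambda F r m)) = D2 (tf (Lambda F r m))) -> D1 =1 D2.
Proof.
move=> dD1 dD2 eqL; apply: derivation_ext => // i.
suff /colP/(_ i) : \col_i D1 (tf 'X_i) = \col_i D2 (tf 'X_i) by rewrite !mxE.
rewrite -[LHS](mulKmx Lambda_jacobian_unit) -[RHS](mulKmx Lambda_jacobian_unit).
rewrite -!derivation_Lambda //; congr (_ *m _); apply/colP => j; rewrite !mxE.
by apply: eqL; have := ltn_ord j; lia.
Qed.

Lemma vfield_Lambda (b : 'cV[K]_r) (i : 'I_r) :
  vfield (invmx (map_mx tf J) *m b) (tf (Lambda F r (r + i))) = b i 0.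
Proof.
set x := _ *m b; have /colP/(_ i) := derivation_Lambda (vfield_derivation x).
rewrite mxE => ->; have -> : \col_i vfield x (tf 'X_i) = x.
  by apply/colP => j; rewrite mxE vfieldX.
by rewrite mulKVmx ?Lambda_jacobian_unit.
Qed.

Lemma Lambda_index (m : nat) : (r <= m <= 2 * r - 1)%N ->
  exists i : 'I_r, m = (r + i)%N.
Proof.
move=> hm; have lr : (m - r < r)%N by lia.
by exists (Ordinal lr); rewrite /=; lia.
Qed.

Lemma dLambda_exists (l : nat) : exists D : K -> K, is_dLambda l D.
Proof.
pose b : 'cV[K]_r := \col_i ((r + i)%N == l)%:R.
exists (vfield (invmx (map_mx tf J) *m b)); split; first exact: vfield_derivation.
by move=> m /Lambda_index[i ->]; rewrite vfield_Lambda mxE.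
Qed.

Lemma calV_exists (n : nat) : (0 < n <= r - 1)%N ->
  exists V : K -> K, is_calV n V.
Proof.
move=> hn; pose b : 'cV[K]_r :=
  \col_i (((r + i)%:R - n%:R) * tf (Lambda F r (r + i + n))).
pose x := invmx (map_mx tf J) *m b.
have x0 (i : 'I_r) : (r - n <= i)%N -> x i 0 = 0.
  apply: (@upper_solve_support _ _ (map_mx tf J) b) => [j k kj|j||j hj].
  - by rewrite mxE Lambda_jacobian_lower // tofrac0.
  - rewrite mxE Lambda_jacobian_diag tofrac_eq0.
    by case: ifP => _; rewrite ?oner_neq0 ?two_cvar_neq0.
  - exact: Lambda_jacobian_unit.
  (* For i >= r-n the index r+i+n is at least 2r, so the prescribed value is 0. *)
  - by rewrite mxE Lambda_gt ?tofrac0 ?mulr0 //; lia.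
exists (vfield x); rewrite /is_calV ifF; last by lia.
split; last by move=> m /Lambda_index[i ->]; rewrite vfield_Lambda mxE.
(* The shift by one is there because c_k is the variable of index k-1. *)
exists (fun k => if insub (k - 1)%N is Some i then x i 0 else 0) => f.
rewrite big_add1 big_mkord /dcvar (@big_ord_widen _ _ _ _ r (fun k =>
  (if insub (k.+1 - 1)%N is Some i then x i 0 else 0) * dcoord (k.+1 - 1) f));
  last exact: leq_subr.
(* The terms with index from r-n on, missing on one side, vanish by [x0]. *)
rewrite big_mkcond; apply: eq_bigr => i _; rewrite subn1 /= valK dcoordE.
by case: ltnP => // /x0 ->; rewrite mul0r.
Qed.

(** * The field V_0 and the formula for all V_n *)

Lemma calV0E : @calV0 F r =1 vfield
  (\col_i ((if (i < r - 1)%N then i.+1 else (2 * r - 1)%N)%:R * tf 'X_i)).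
Proof.
have lr : (r - 1 < r)%N by lia.
move=> f; rewrite /calV0 /vfield /Lambda_top /dLambda_top.
rewrite (dcoordE (Ordinal lr)) (coordE (Ordinal lr)).
rewrite [RHS](bigD1 (Ordinal lr)) //= addrC mxE /= ltnn; congr (_ + _).
rewrite big_add1 big_mkord /dcvar -subn1 (@big_ord_widen _ _ _ _ r (fun k =>
  k.+1%:R * tf (cvar F r k.+1) * dcoord (k.+1 - 1) f)) ?leq_subr //.
apply: eq_big => [i|i ir]; last by rewrite mxE ir cvarE // subn1 dcoordE.
by rewrite -val_eqE /=; have := ltn_ord i; lia.
Qed.

Lemma calV0_derivation : is_derivation (@calV0 F r).
Proof.
have [A M C] := vfield_derivation
  (\col_i ((if (i < r - 1)%N then i.+1 else (2 * r - 1)%N)%:R * tf 'X_i)).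
by split=> *; rewrite !calV0E.
Qed.

Lemma calV0_cvar (a : nat) : calV0 (tf (cvar F r a)) = a%:R * tf (cvar F r a).
Proof.
have [ha|ha] := boolP ((a == 0%N) || (r <= a)%N).
  by rewrite cvar_out // tofrac0 (derivation0 calV0_derivation) mulr0.
have lr : (a - 1 < r)%N by lia.
have -> : a = (Ordinal lr).+1 by rewrite /=; lia.
have ir : (Ordinal lr < r - 1)%N by rewrite /=; lia.
by rewrite cvarE // calV0E vfieldX mxE ir.
Qed.

(* [calV0] multiplies c_a by a, hence every c_a c_(m-a) by m. *)
Lemma calV0_Lambda (m : nat) : (r <= m <= 2 * r - 1)%N ->
  calV0 (tf (Lambda F r m)) = m%:R * tf (Lambda F r m).
Proof.
move=> hm; have [lt|ge] := ltnP m (2 * r - 1).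
  have dV := calV0_derivation; have [_ M _] := dV.
  rewrite Lambda_lt ?lt ?andbT; last by lia.
  rewrite tofracN (derivationN dV) mulrN; congr (- _).
  rewrite rmorph_sum (derivation_sum _ _ _ dV) mulr_sumr.
  apply: eq_big_nat => a ha /=; rewrite tofracM M !calV0_cvar.
  have -> : m%:R = a%:R + (m - a)%:R :> K by rewrite -natrD subnKC //; lia.
  by ring.
have -> : m = (2 * r - 1)%N by lia.
have lr : (r - 1 < r)%N by lia.
rewrite Lambda_last /Lambda_top (coordE (Ordinal lr)) calV0E vfieldX mxE /=.
by rewrite ltnn.
Qed.

(** Puts n = 0, defined by an explicit field, and n >= 1, defined by values on the Lambda_m, on the
    same footing. *)
Lemma calV_spec (n : nat) (V : K -> K) : (n <= r - 1)%N -> is_calV n V ->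
  is_derivation V /\ forall m, (r <= m <= 2 * r - 1)%N ->
    V (tf (Lambda F r m)) = (m%:R - n%:R) * tf (Lambda F r (m + n)).
Proof.
move=> hn; rewrite /is_calV; case: eqP => [-> VE|n0 [[h VE] VL]].
  have [A M C] := calV0_derivation; split; first by split=> *; rewrite !VE.
  by move=> m hm; rewrite VE calV0_Lambda // subr0 addn0.
split=> //; have [A M C] : is_derivation (fun f : K =>
    \sum_(k <- index_iota 1 (r - n).+1) h k * dcvar k f).
  apply: derivation_comb => k; rewrite /dcvar /dcoord.
  case: insub => [i|]; first exact: fpartial_derivation.
  by split=> *; rewrite ?mul0r ?mulr0 ?addr0.
by split=> *; rewrite !VE.
Qed.

(** Both sides are derivations, so comparing them on each Lambda_m suffices. *)
Lemma calV_formula (dLambda : nat -> K -> K) (n : nat) (V : K -> K) :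
  (forall l, (r <= l <= 2 * r - 1)%N -> is_dLambda l (dLambda l)) ->
  (n <= r - 1)%N -> is_calV n V ->
  V =1 fun f => \sum_(r <= l < (2 * r - n)%N)
    (l%:R - n%:R) * tf (Lambda F r (l + n)) * dLambda l f.
Proof.
move=> dL hn /(calV_spec hn) [dV VL].
(* Extension by the zero derivation, since [derivation_comb] wants a derivation at every index. *)
pose D l := if (r <= l <= 2 * r - 1)%N then dLambda l else fun=> 0.
have dD l : is_derivation (D l).
  rewrite /D; case: ifP => [/dL[]//|_].
  by split=> *; rewrite ?mul0r ?mulr0 ?addr0.
pose W (f : K) := \sum_(l <- index_iota r (2 * r - n))
  (l%:R - n%:R) * tf (Lambda F r (l + n)) * D l f.
have WE f : W f = \sum_(r <= l < (2 * r - n)%N)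
    (l%:R - n%:R) * tf (Lambda F r (l + n)) * dLambda l f.
  by apply: eq_big_nat => l hl; rewrite /D ifT //; lia.
move=> f; rewrite -WE; move: f.
apply: (derivation_Lambda_ext dV); first exact: derivation_comb.
move=> m hm; rewrite VL // WE.
transitivity (\sum_(r <= l < (2 * r - n)%N) (l == m)%:R *
    ((l%:R - n%:R) * tf (Lambda F r (l + n)))).
  (* Only l = m survives; when m >= 2r-n this term is absent from the sum, and Lambda_(m+n) = 0 as
     well. *)
  rewrite sum_delta; case: ifP => // h.
  by rewrite Lambda_gt ?tofrac0 ?mulr0 //; lia.
apply: eq_big_nat => l hl; have [|_ ->//] := dL l; first by lia.
by rewrite mulrC eq_sym.
Qed.

End Coordinates.

Theorem corollary4p2 (F : fieldType) (charF0 : [pchar F] =i pred0)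
    (r : nat) (r_ge2 : (2 <= r)%N) :
  (* Lambda_r, ..., Lambda_(2r-1) is a rational coordinate system
     on the open set c_(r-1) <> 0 *)
  [/\ unit_after_localization (cvar F r (r - 1))
        (jacobian (fun i : 'I_r => Lambda F r (r + i))),
      (* rational derivations are determined by their values on it, and the
         derivations d/dLambda_l exist *)
      forall D1 D2 : ratfun F r -> ratfun F r,
        is_derivation D1 -> is_derivation D2 ->
        (forall m, (r <= m <= 2 * r - 1)%N ->
           D1 (tofrac (Lambda F r m)) = D2 (tofrac (Lambda F r m))) ->
        D1 =1 D2,
      forall l, (r <= l <= 2 * r - 1)%N ->
        exists D : ratfun F r -> ratfun F r, is_dLambda l D
      (* the vector fields V_n are well defined and given by the formula *)
    & forall dLambda : nat -> ratfun F r -> ratfun F r,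
        (forall l, (r <= l <= 2 * r - 1)%N -> is_dLambda l (dLambda l)) ->
        forall n, (n <= r - 1)%N ->
          (exists V : ratfun F r -> ratfun F r, is_calV n V) /\
          forall V : ratfun F r -> ratfun F r, is_calV n V ->
            forall f, V f =
              \sum_(r <= l < (2 * r - n)%N)
                (l%:R - n%:R) * tofrac (Lambda F r (l + n)) * dLambda l f].
Proof.
split=> [||l hl|dLambda dL n hn].
- exact: Lambda_jacobian_localization.
- exact: derivation_Lambda_ext.
- exact: dLambda_exists.
- split; last by move=> V VP f; exact: calV_formula.
  have [->|n0] := eqVneq n 0%N; first by exists (@calV0 F r).
  by apply: calV_exists; rewrite // lt0n n0.
Qed.
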